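(* There is a tight proper coloring $F:{}^{\omega}\omega\to\omega$ that does not depend on finitely many coordinates.
   Context: ${}^{\omega}\omega$ is the set of functions from $\omega$ to $\omega$. Write $x\perp y$ if $x(i)\ne y(i)$ for all $i\in\omega$. $F:{}^{\omega}\omega\to\omega$ is a proper coloring if $F(x)\ne F(y)$ whenever $x\perp y$. A proper coloring $F$ is tight if for all $x\in{}^{\omega}\omega$ and $\beta\in\omega$ with $F(x)\ne\beta$ there is $y\in{}^{\omega}\omega$ with $y\perp x$ and $F(y)=\beta$. $F$ depends on finitely many coordinates if there is a finite set $S\subset\omega$ such that $F(x)=F(y)$ for all $x,y\in{}^{\omega}\omega$ with $x(i)=y(i)$ for every $i\in S$. *)

(* Defs.v *)
From Stdlib Require Import List.

Definition baire : Type := nat -> nat.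

Definition perp (x y : baire) : Prop := forall i : nat, x i <> y i.

Definition proper_coloring (F : baire -> nat) : Prop :=
  forall x y : baire, perp x y -> F x <> F y.

Definition tight (F : baire -> nat) : Prop :=
  forall (x : baire) (b : nat),
    F x <> b -> exists y : baire, perp y x /\ F y = b.

(* A finite set of coordinates is given by a list enumerating it; order and
   repetitions are irrelevant, since only membership is used. *)
Definition depends_on_finitely_many_coordinates (F : baire -> nat) : Prop :=
  exists S : list nat,
    forall x y : baire, (forall i : nat, In i S -> x i = y i) -> F x = F y.

(* Main.v *)
(** For [x], put [k = x 0 / 2] and look at the triple [(x 0, x 1, x (k + 2))].
    Halving each entry places the triple in a cube of eight triples, which the
    parity of the sum splits into two tetrahedra; the color of [x] is the
    tetrahedron, and it determines [k].  Two triples of a cube that differ in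
    all entries have opposite parities, so the coloring is proper.  It is tight
    because for any triple outside a tetrahedron some vertex of the tetrahedron
    differs from it in all entries: the antipode if the triple lies in the same
    cube; otherwise one entry is automatically avoided and is free to adjust the
    parity.  As [k] is arbitrary, every coordinate matters. *)

From Stdlib Require Import List Arith ZArith ZifyNat Cantor Lia.
Require Import Defs.

Ltac Zify.zify_post_hook ::= Z.to_euclidean_division_equations.

(** Cantor pairing numbers the tetrahedra; [2 * (c / 2)] leaves the lowest bit free for the parity,
    so that every natural number is a color. *)
Definition tetrahedron (a b c : nat) : nat :=
  to_nat (a / 2, to_nat (b / 2, 2 * (c / 2) + (a + b + c) mod 2)).

Lemma tetrahedron_eq (a b c a' b' c' : nat) :
  tetrahedron a b c = tetrahedron a' b' c' <->
  a / 2 = a' / 2 /\ b / 2 = b' / 2 /\ c / 2 = c' / 2 /\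
  (a + b + c) mod 2 = (a' + b' + c') mod 2.
Proof.
  unfold tetrahedron; split.
  - intros [H0 H]%to_nat_inj%pair_equal_spec.
    apply to_nat_inj, pair_equal_spec in H as [H1 H2].
    lia.
  - intros (-> & -> & -> & ->); reflexivity.
Qed.

Lemma tetrahedron_surjective (n : nat) : exists a b c, tetrahedron a b c = n.
Proof.
  destruct (of_nat n) as [h m] eqn:Hn.
  destruct (of_nat m) as [i d] eqn:Hm.
  apply (f_equal to_nat) in Hn, Hm; rewrite cancel_to_of in Hn, Hm; subst.
  exists (2 * h + d mod 2), (2 * i), (2 * (d / 2)); unfold tetrahedron.
  do 2 f_equal; [lia |].
  do 2 f_equal; lia.
Qed.

(** Distinct entries with equal halves differ by exactly 1, so changing all three flips the parity
    of the sum. *)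
Lemma tetrahedron_proper (a b c a' b' c' : nat) :
  a <> a' -> b <> b' -> c <> c' -> tetrahedron a b c <> tetrahedron a' b' c'.
Proof.
  intros Ha Hb Hc H; apply tetrahedron_eq in H; lia.
Qed.

Lemma same_half_avoiding (a b : nat) : exists u, u / 2 = b / 2 /\ u <> a.
Proof.
  exists (2 * (b / 2) + (1 - a mod 2)); lia.
Qed.

Lemma same_half_parity (b p q : nat) :
  exists u, u / 2 = b / 2 /\ (u + p) mod 2 = q mod 2.
Proof.
  exists (2 * (b / 2) + (p + q) mod 2); lia.
Qed.

Lemma tetrahedron_tight (a b c a' b' c' : nat) :
  tetrahedron a b c <> tetrahedron a' b' c' ->
  exists u v w, u <> a /\ v <> b /\ w <> c /\
    tetrahedron u v w = tetrahedron a' b' c'.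
Proof.
  intros H; rewrite tetrahedron_eq in H.
  enough (exists u v w, u <> a /\ v <> b /\ w <> c /\
            u / 2 = a' / 2 /\ v / 2 = b' / 2 /\ w / 2 = c' / 2 /\
            (u + v + w) mod 2 = (a' + b' + c') mod 2)
    as (u & v & w & Hu & Hv & Hw & E)
    by (exists u, v, w; rewrite tetrahedron_eq; auto).
  destruct (Nat.eq_dec (a / 2) (a' / 2)) as [Ea | Ea];
    [destruct (Nat.eq_dec (b / 2) (b' / 2)) as [Eb | Eb] |].
  - destruct (same_half_avoiding a a') as (u & Hu & Hua).
    destruct (same_half_avoiding b b') as (v & Hv & Hvb).
    destruct (same_half_parity c' (u + v) (a' + b' + c')) as (w & Hw & E).
    rewrite (Nat.add_comm w) in E.
    exists u, v, w; repeat split; auto.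
    (* If [w = c], all halves agree, and [u], [v] differ by 1 from [a], [b], so the parities agree
       too, against [H]. *)
    intros ->; apply H; repeat split; auto.
    rewrite <- E.
    clear - Ea Eb Hu Hv Hua Hvb.
    lia.
  (* Any [v] with half [b' / 2] now avoids [b], so [v] can fix the parity. *)
  - destruct (same_half_avoiding a a') as (u & Hu & Hua).
    destruct (same_half_avoiding c c') as (w & Hw & Hwc).
    destruct (same_half_parity b' (u + w) (a' + b' + c')) as (v & Hv & E).
    exists u, v, w; repeat split; auto.
    + intros ->; auto.
    + rewrite <- E; f_equal; lia.
  - destruct (same_half_avoiding b b') as (v & Hv & Hvb).
    destruct (same_half_avoiding c c') as (w & Hw & Hwc).
    destruct (same_half_parity a' (v + w) (a' + b' + c')) as (u & Hu & E).
    exists u, v, w; repeat split; auto.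
    + intros ->; auto.
    + rewrite <- E; f_equal; lia.
Qed.

Definition tetrahedron_coloring (x : baire) : nat :=
  tetrahedron (x 0) (x 1) (x (x 0 / 2 + 2)).

Lemma tetrahedron_coloring_proper : proper_coloring tetrahedron_coloring.
Proof.
  intros x y Hxy E.
  assert (Hk : x 0 / 2 = y 0 / 2) by (apply tetrahedron_eq in E; apply E).
  revert E; unfold tetrahedron_coloring; rewrite Hk.
  apply tetrahedron_proper; apply Hxy.
Qed.

Lemma tetrahedron_coloring_tight : tight tetrahedron_coloring.
Proof.
  intros x n Hx.
  destruct (tetrahedron_surjective n) as (a & b & c & <-).
  set (k := a / 2).
  (* The position [k + 2] comes from the target color; if the tetrahedra were equal, [x] would read
     the same position and have that color. *)
  assert (H : tetrahedron (x 0) (x 1) (x (k + 2)) <> tetrahedron a b c).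
  { intros E; apply Hx; rewrite <- E; unfold tetrahedron_coloring.
    apply tetrahedron_eq in E as [E _]; rewrite E; reflexivity. }
  destruct (tetrahedron_tight _ _ _ _ _ _ H) as (u & v & w & Hu & Hv & Hw & E).
  exists (fun i => if i =? 0 then u else if i =? 1 then v
                   else if i =? k + 2 then w else S (x i)).
  split.
  - intros i.
    destruct (Nat.eqb_spec i 0) as [-> | _]; [exact Hu |].
    destruct (Nat.eqb_spec i 1) as [-> | _]; [exact Hv |].
    destruct (Nat.eqb_spec i (k + 2)) as [-> | _]; [exact Hw | lia].
  - assert (Hk : u / 2 = k) by (apply tetrahedron_eq in E; apply E).
    unfold tetrahedron_coloring; cbv beta.
    change (0 =? 0) with true; change (1 =? 0) with false;
      change (1 =? 1) with true; cbv iota.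
    rewrite Hk, Nat.eqb_refl.
    destruct (Nat.eqb_spec (k + 2) 0); [lia |].
    destruct (Nat.eqb_spec (k + 2) 1); [lia | exact E].
Qed.

Lemma tetrahedron_coloring_infinite_dependence :
  ~ depends_on_finitely_many_coordinates tetrahedron_coloring.
Proof.
  intros [S HS].
  set (k := list_max S).
  (* The entry [2 * k] directs the reading to [k + 2], beyond all of [S], where [t] decides the
     parity. *)
  set (x := fun t i => if i =? 0 then 2 * k else if i =? k + 2 then t else 0).
  assert (Hx : forall t, tetrahedron_coloring (x t) = tetrahedron (2 * k) 0 t).
  { intros t; unfold tetrahedron_coloring.
    replace (x t 0) with (2 * k) by reflexivity.
    replace (2 * k / 2) with k by lia.
    f_equal; unfold x.
    - destruct (Nat.eqb_spec 1 (k + 2)); [lia | reflexivity].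
    - rewrite Nat.eqb_refl; destruct (Nat.eqb_spec (k + 2) 0); [lia | reflexivity]. }
  assert (E : tetrahedron_coloring (x 0) = tetrahedron_coloring (x 1)).
  { apply HS; intros i Hi; unfold x.
    assert (Hik : i <= k).
    { pose proof (proj1 (list_max_le S k) (le_n _)) as Hmax.
      rewrite Forall_forall in Hmax; exact (Hmax i Hi). }
    destruct (Nat.eqb_spec i (k + 2)); [lia | reflexivity]. }
  rewrite !Hx in E; apply tetrahedron_eq in E; lia.
Qed.

Theorem theorem7p14 :
  exists F : baire -> nat,
    proper_coloring F /\ tight F /\ ~ depends_on_finitely_many_coordinates F.
Proof.
  exists tetrahedron_coloring; split; [| split].
  - exact tetrahedron_coloring_proper.
  - exact tetrahedron_coloring_tight.
  - exact tetrahedron_coloring_infinite_dependence.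
Qed.
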